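(* Let $\alpha\ge1$ be an integer and let $G=(V,E)$ be a graph with chromatic number $\chi(G)\le\alpha$. Then $G$ admits a partial edge colouring with at most $3\lceil\log_2\alpha\rceil+16$ colours such that every non-isolated edge of $G$ is satisfied.
   Context: For an edge $e=uv$, $E[e]$ is the set of edges incident with $u$ or $v$ and $E(e)=E[e]\setminus\{e\}$; $e$ is isolated if $E(e)=\emptyset$. In a partial edge colouring (not all edges need be coloured), a colour $\beta$ is unique for $e$ if $\beta$ appears on some edge $e'\in E(e)$ and on no other edge of $E[e]\setminus\{e'\}$; $e$ is satisfied if such a colour exists. *)

(* Defs.v *)
From mathcomp Require Import all_boot.
Set Implicit Arguments. Unset Strict Implicit. Unset Printing Implicit Defensive.

Definition simple_graph (V : finType) (adj : rel V) : Prop :=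
  symmetric adj /\ irreflexive adj.

Definition edges (V : finType) (adj : rel V) : {set {set V}} :=
  [set e : {set V} | [exists u, exists v, adj u v && (e == [set u; v])]].

Definition chromatic_le (V : finType) (adj : rel V) (a : nat) : Prop :=
  exists f : V -> 'I_a, forall u v, adj u v -> f u != f v.

Definition closed_nbh (V : finType) (adj : rel V) (e : {set V}) : {set {set V}} :=
  [set f in edges adj | ~~ [disjoint f & e]].
Definition open_nbh (V : finType) (adj : rel V) (e : {set V}) : {set {set V}} :=
  closed_nbh adj e :\ e.

Definition isolated_edge (V : finType) (adj : rel V) (e : {set V}) : Prop :=
  open_nbh adj e = set0.

(* a partial edge colouring with k colours: option 'I_k, None = uncoloured *)
Definition unique_colour (V : finType) (adj : rel V) (k : nat)
  (c : {set V} -> option 'I_k) (e : {set V}) (b : 'I_k) : Prop :=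
  exists2 e', e' \in open_nbh adj e &
    c e' = Some b /\
    forall f, f \in closed_nbh adj e -> f != e' -> c f != Some b.

Definition satisfied (V : finType) (adj : rel V) (k : nat)
  (c : {set V} -> option 'I_k) (e : {set V}) : Prop :=
  exists b : 'I_k, unique_colour adj c e b.

(* Main.v *)
Require Import Defs.
From mathcomp Require Import all_boot.

(** Breadth-first layers. In every component that is not a single edge, root a
    breadth-first tree at a vertex with two neighbours and colour the edge from
    [x] to its parent by (depth of [x] mod 3, tag of [x]), where two children of
    the root carry tags of their own. An edge [uv] joining consecutive layers
    with [u] above [v] then sees the colour of the parent edge of [u] only once
    (if [u] is the root, a specially tagged root edge does the job), and so does
    an edge inside a layer whose ends have different tags.

    Edges inside layers. The [k] bits of a proper vertex colouring split these
    edges into [k] bipartite levels. If two adjacent edges are isolated in their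
    respective levels, one of them can be moved to the level of the other; hence
    we may assume that the edges isolated in their level form a matching, and
    then one bit of the tag satisfies all of them.

    A bipartite level with sides [X] and [Y]. Assign to each [y] a neighbour
    [s y], with as few centres (values of [s]) as possible and then as few centres
    of fibre size one as possible. By minimality each centre [x] has a private
    neighbour [p x], adjacent to no other centre. The edges [x (p x)] get the
    second colour and the other assigned edges the first one; where [x (p x)] does
    not see the first colour exactly once, one edge adjacent to it gets the third
    colour.

    Altogether [3 k + 12] colours are used. *)

Set Implicit Arguments. Unset Strict Implicit. Unset Printing Implicit Defensive.

(* An edge incident with [e] is written as an ordered pair starting in [e]; the
   last clause also excludes [e] itself, since [z] lies outside [e]. *)
Definition pair_satisfied (V : finType) (K : Type) (col : V -> V -> option K)
    (e : {set V}) : Prop :=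
  exists b a z, [/\ a \in e, z \notin e, col a z = Some b &
    forall a' z', a' \in e -> col a' z' = Some b -> a' = a /\ z' = z].

(** * Colouring one bipartite level with three colours *)

Section BipartiteColouring.

Variables (V : finType) (H : rel V) (g : pred V).
Hypothesis symH : symmetric H.
Hypothesis bipH : forall u v, H u v -> g u != g v.

(** The side X is where [g] holds; a vertex of Y without neighbours needs no centre. *)
Definition dominated (y : V) : bool := ~~ g y && [exists x, H x y].
Definition dominating (s : {ffun V -> V}) : bool :=
  [forall y, dominated y ==> H (s y) y].
Definition fibre (s : {ffun V -> V}) (x : V) : {set V} :=
  [set y | dominated y && (s y == x)].
Definition centres (s : {ffun V -> V}) : {set V} :=
  [set x | fibre s x != set0].
Definition single_centres (s : {ffun V -> V}) : {set V} :=
  [set x | #|fibre s x| == 1].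
(** The factor [#|V|.+1] exceeds every possible number of single centres, so the minimum is
    lexicographic: centres first, single centres second. *)
Definition cost (s : {ffun V -> V}) : nat :=
  #|centres s| * #|V|.+1 + #|single_centres s|.

Lemma exists_optimal_dominating :
  exists s, dominating s /\ forall s', dominating s' -> cost s <= cost s'.
Proof.
pose s0 : {ffun V -> V} := [ffun y => odflt y [pick x | H x y]].
have ds0 : dominating s0.
  apply/forallP=> y; apply/implyP=> /andP[_ /existsP[x Hxy]].
  by rewrite ffunE; case: pickP => //= /(_ x); rewrite Hxy.
by case: (arg_minnP cost ds0) => s ds mins; exists s.
Qed.

Section Optimal.

Variable s : {ffun V -> V}.
Hypothesis dom_s : dominating s.
Hypothesis opt_s : forall s', dominating s' -> cost s <= cost s'.

Lemma mem_fibre x y : (y \in fibre s x) = dominated y && (s y == x).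
Proof. by rewrite inE. Qed.

Lemma fibreP x y : y \in fibre s x -> [/\ H x y, g x, ~~ g y & s y = x].
Proof.
rewrite inE => /andP[dy /eqP sy].
have Hxy : H x y by move/forallP/(_ y): dom_s; rewrite dy sy.
have ny : ~~ g y by case/andP: dy.
by split=> //; move: (bipH Hxy); rewrite (negbTE ny); case: (g x).
Qed.

Lemma centresP x : reflect (exists y, y \in fibre s x) (x \in centres s).
Proof. by rewrite inE; apply: set0Pn. Qed.

Lemma fibre_centre x y : y \in fibre s x -> x \in centres s.
Proof. by move=> yx; apply/centresP; exists y. Qed.

Lemma dominated_fibre x y : H x y -> g x -> y \in fibre s (s y).
Proof.
move=> Hxy gx; rewrite inE eqxx andbT /dominated.
apply/andP; split; last by apply/existsP; exists x.
by move: (bipH Hxy); rewrite gx; case: (g y).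
Qed.

(** Were every vertex in the fibre of [x] adjacent to another centre, the whole fibre could be
    handed over to other centres. This removes the centre [x] and creates none, against
    optimality. *)
Lemma centre_private x : x \in centres s -> exists2 y, y \in fibre s x &
  forall x', x' \in centres s -> H x' y -> x' = x.
Proof.
move=> xS.
pose priv y := [forall x', (x' \in centres s) && H x' y ==> (x' == x)].
have [/existsP[y /andP[yx /forallP py]]|/existsPn nopriv] :=
  boolP [exists y, (y \in fibre s x) && priv y].
  exists y => // x' x'S Hx'; apply/eqP; move/implyP: (py x'); apply.
  by rewrite x'S.
pose s' : {ffun V -> V} := [ffun y => if y \in fibre s x then
  odflt y [pick x' | [&& x' \in centres s, H x' y & x' != x]] else s y].
have s'P y : y \in fibre s x -> [&& s' y \in centres s, H (s' y) y & s' y != x].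
  move=> yx; rewrite ffunE yx; case: pickP => //= none.
  case/negP: (nopriv y); rewrite yx /=; apply/forallP=> x'.
  by apply/implyP=> /andP[x'S Hx']; move: (none x'); rewrite x'S Hx' /= => /negbFE.
have ds' : dominating s'.
  apply/forallP=> y; apply/implyP=> dy.
  have [yx|yx] := boolP (y \in fibre s x); first by case/and3P: (s'P y yx).
  by rewrite ffunE (negbTE yx); move/forallP/(_ y): dom_s; rewrite dy.
have sub : centres s' \subset centres s :\ x.
  apply/subsetP=> z; rewrite inE => /set0Pn[y]; rewrite inE => /andP[dy /eqP <-].
  have [yx|yx] := boolP (y \in fibre s x).
    by case/and3P: (s'P y yx) => A _ B; rewrite inE A inE B.
  rewrite ffunE (negbTE yx) in_setD1.
  apply/andP; split; first by move: yx; rewrite inE dy.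
  by apply: (@fibre_centre _ y); rewrite inE dy eqxx.
(* One centre fewer saves [#|V|.+1], while single centres add at most [#|V|]. *)
move: (opt_s ds') (subset_leq_card sub) (max_card (single_centres s')) (cardsD1 x (centres s)).
rewrite xS /cost => le1 le2 le3 eqc.
exfalso.
move: le1; rewrite eqc leqNgt => /negP; apply.
rewrite add1n mulSn addnC -addnA -addSn leq_add // (leq_trans _ (leq_addr _ _)) //.
by rewrite leq_mul2r le2 orbT.
Qed.

(* Reassigning both [z] and [y] to [x'] would trade the single centre [x] for
   a centre that is not single. *)
Lemma single_neighbour_fibre x x' y z :
  fibre s x = [set z] -> (x' == x) || (x' \notin centres s) ->
  H x' z -> H x' y -> y != z -> #|fibre s (s y)| <= 2.
Proof.
move=> fx x'S Hz Hy yz; rewrite leqNgt; apply/negP=> big.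
have zx : z \in fibre s x by rewrite fx inE.
have [_ gx nz sz] := fibreP zx.
have gx' : g x' by move: (bipH Hz); rewrite (negbTE nz); case: (g x').
have yf : y \in fibre s (s y) := dominated_fibre Hy gx'.
have dy : dominated y by move: yf; rewrite inE => /andP[].
have dz : dominated z by move: zx; rewrite inE => /andP[].
have syx : s y != x.
  by apply: contraNneq yz => syx; move: yf; rewrite syx fx inE.
have syx' : s y != x'.
  case/orP: x'S => [/eqP->//|]; apply: contraNneq => <-; exact: fibre_centre yf.
pose s' : {ffun V -> V} := [ffun w => if (w == z) || (w == y) then x' else s w].
have ds' : dominating s'.
  apply/forallP=> w; apply/implyP=> dw; rewrite ffunE.
  case: eqP => [->//|_] /=; case: eqP => [->//|_].
  by move/forallP/(_ w): dom_s; rewrite dw.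
(* As [z] was the whole fibre of [x], either [x'] replaces the centre [x] or [x' = x]. *)
have sub : centres s' \subset x' |: centres s :\ x.
  apply/subsetP=> u; rewrite inE => /set0Pn[w]; rewrite inE ffunE => /andP[dw].
  case: ifP => [_ /eqP<-|/norP[wz wy] /eqP<-]; first by rewrite setU11.
  rewrite in_setU1 in_setD1 (@fibre_centre _ w) ?andbT; last by rewrite inE dw eqxx.
  apply/orP; right; apply: contraNneq wz => swx.
  by rewrite -in_set1 -fx inE dw swx eqxx.
have cle : #|centres s'| <= #|centres s|.
  rewrite (leq_trans (subset_leq_card sub)) // (cardsD1 x (centres s)).
  rewrite (fibre_centre zx) cardsU1; apply: leq_add => //; exact: leq_b1.
(* The fibre of [x'] now contains [y] and [z], that of [s y] keeps at least two elements after
   losing [y], and the others, apart from that of [x], do not change. *)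
have sub1 : single_centres s' \subset single_centres s :\ x.
  apply/subsetP=> u; rewrite inE => /cards1P[w fu].
  have [ux'|ux'] := eqVneq u x'.
    have: z \in fibre s' u by rewrite inE dz ffunE eqxx ux' eqxx.
    have: y \in fibre s' u by rewrite inE dy ffunE eqxx orbT ux' eqxx.
    by rewrite fu !inE => /eqP<- /eqP zy; rewrite zy eqxx in yz.
  have [us|us] := eqVneq u (s y).
    suff: 1 < #|fibre s' u| by rewrite fu cards1.
    apply: leq_trans (_ : #|fibre s (s y) :\ y| <= _).
      by rewrite (cardsD1 y) yf in big.
    apply: subset_leq_card; apply/subsetP=> v.
    rewrite !inE ffunE => /and3P[vy dv /eqP sv]; rewrite dv (negbTE vy) orbF.
    case: (v =P z) => [vz|_] /=; last by rewrite sv us.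
    by move: syx; rewrite -sv vz sz eqxx.
  have eqf v : v \in fibre s' u -> v \in fibre s u /\ v != z.
    rewrite !inE ffunE; case: ifP => [_|/norP[vz _]]; last by move=> ->.
    by rewrite [x' == u]eq_sym (negbTE ux') andbF.
  have [uf wz] : w \in fibre s u /\ w != z by apply: eqf; rewrite fu inE.
  have ux : u != x by apply: contraNneq wz => ux; rewrite -in_set1 -fx -ux.
  rewrite !inE ux /=; apply/cards1P; exists w; rewrite -fu; apply/setP=> v.
  rewrite !inE ffunE; case: (dominated v) => //=.
  case: (v =P z) => [->|_] /=; first by rewrite sz eq_sym (negbTE ux) eq_sym (negbTE ux').
  by case: (v =P y) => [->|_] //=; rewrite eq_sym (negbTE us) eq_sym (negbTE ux').
have xs : x \in single_centres s by rewrite inE fx cards1.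
move: (opt_s ds'); rewrite leqNgt => /negP; apply.
rewrite /cost -addnS; apply: leq_add; first by rewrite leq_mul2r cle orbT.
by rewrite (cardsD1 x (single_centres s)) xs ltnS subset_leq_card.
Qed.

(** * The three colours and their verification *)

Definition private_nbr (x : V) : V := odflt x [pick y | (y \in fibre s x) &&
  [forall x', (x' \in centres s) && H x' y ==> (x' == x)]].
Local Notation p := private_nbr.

Lemma private_nbrP x : x \in centres s -> p x \in fibre s x /\
  forall x', x' \in centres s -> H x' (p x) -> x' = x.
Proof.
move=> xS; rewrite /p; case: pickP => [y /andP[yx /forallP py]|none] /=.
  split=> // x' x'S Hx'; apply/eqP; move/implyP: (py x'); apply.
  by rewrite x'S.
have [y yx py] := centre_private xS; move: (none y); rewrite yx /=.
by case/negP; apply/forallP=> x'; apply/implyP=> /andP[? ?]; apply/eqP/py.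
Qed.

Definition second_nbr (x : V) : V := odflt x [pick y in fibre s x | y != p x].
Local Notation q := second_nbr.

Lemma second_nbrP x : 1 < #|fibre s x| -> q x \in fibre s x /\ q x != p x.
Proof.
move=> gt1; rewrite /q; case: pickP => [y /andP[]//|none] /=.
suff: #|fibre s x| <= #|[set p x]| by rewrite cards1 leqNgt gt1.
apply/subset_leq_card/subsetP=> y yx; rewrite inE.
by move: (none y); rewrite yx /= => /negbFE.
Qed.

(** For a centre [x], the exclusive or selects the edges adjacent to [x (p x)] and different from
    it. *)
Definition incident_edge (x : V) : option (V * V) :=
  [pick w : V * V | [&& H w.1 w.2, g w.1 & (w.1 == x) (+) (w.2 == p x)]].

Local Notation c0 := (@Ordinal 3 0 isT).
Local Notation c1 := (@Ordinal 3 1 isT).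
Local Notation c2 := (@Ordinal 3 2 isT).

(** The edge [x (p x)] should see [c0] exactly once. If the fibre of [x] has two or more further
    elements, one of them gets [c2] instead; if it has none, an adjacent unassigned edge gets
    [c2]. *)
Definition star_colour (x y : V) : option 'I_3 :=
  if y \in fibre s x then
    Some (if y == p x then c1
          else if (2 < #|fibre s x|) && (y == q x) then c2 else c0)
  else if [exists x0 in single_centres s, incident_edge x0 == Some (x, y)]
  then Some c2 else None.
Local Notation c := star_colour.

Lemma star_colour_edge x y : c x y -> H x y /\ g x.
Proof.
rewrite /c; case: ifP => [/fibreP[]//|_].
case: ifP => // /existsP[x0 /andP[_]].
rewrite /incident_edge; case: pickP => // w /and3P[Hw gw _] /eqP[ew].
by rewrite ew in Hw gw.
Qed.

Lemma star_colour0 x y : c x y = Some c0 -> y \in fibre s x /\ y != p x.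
Proof.
rewrite /c; case: ifP => [yx|_]; last by case: ifP.
by case: eqVneq => // yp; case: ifP.
Qed.

Lemma star_colour1 x y : c x y = Some c1 -> y \in fibre s x /\ y = p x.
Proof.
rewrite /c; case: ifP => [yx|_]; last by case: ifP.
by case: eqVneq => // yp; case: ifP.
Qed.

Lemma star_colour2 x y : c x y = Some c2 ->
  [/\ y \in fibre s x, y != p x, 2 < #|fibre s x| & y = q x] \/
  exists x0, [/\ fibre s x0 = [set p x0], incident_edge x0 = Some (x, y),
    H x y & (x == x0) (+) (y == p x0)].
Proof.
rewrite /c; case: ifP => [yx|_].
  by case: eqVneq => // yp; case: ifP => // /andP[? /eqP?]; left.
case: ifP => // /existsP[x0 /andP[xs /eqP ex]] _; right; exists x0.
have /cards1P[z fz] : #|fibre s x0| == 1 by rewrite inE in xs.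
have xS : x0 \in centres s by apply: (@fibre_centre _ z); rewrite fz inE.
have [px _] := private_nbrP xS.
split=> //; first by rewrite fz; move: px; rewrite fz inE => /eqP->.
  by move: ex; rewrite /incident_edge; case: pickP => // w /and3P[? ? ?] [e]; subst w.
by move: ex; rewrite /incident_edge; case: pickP => // w /and3P[? ? ?] [e]; subst w.
Qed.

(** If [x] is no centre, the only assigned edge adjacent to [x y] joins [y] to [s y], and its colour
    works. If [x] is a centre and [y] is not [p x], the edge [x (p x)] works because [p] picks
    private neighbours. If [y = p x], the size of the fibre of [x] decides. *)
Lemma star_colour_spec x y : H x y -> g x ->
  (exists z, H x z && (z != y) || H y z && (z != x)) ->
  exists b, (exists a z, [/\ c a z = Some b, (a == x) (+) (z == y) &
    forall a' z', c a' z' = Some b -> (a' == x) || (z' == y) -> a' = a /\ z' = z]).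
Proof.
move=> Hxy gx noniso.
have yf := dominated_fibre Hxy gx.
have [xS|xS] := boolP (x \in centres s); last first.
  have syx : s y != x by apply: contraNneq xS => <-; exact: fibre_centre yf.
  have [yp|yp] := eqVneq y (p (s y)).
    exists c1, (s y), y; split; rewrite ?eqxx ?(negbTE syx) //.
      by rewrite /c yf -yp eqxx.
    move=> a z /star_colour1[zf _] /orP[/eqP ax|/eqP zy]; last first.
      by move: zf; rewrite zy => /fibreP[].
    by case/negP: xS; rewrite -ax; apply: fibre_centre zf.
  have [/andP[big /eqP yq]|small] := boolP ((2 < #|fibre s (s y)|) && (y == q (s y))).
    exists c2, (s y), y; split; rewrite ?eqxx ?(negbTE syx) //.
      by rewrite /c yf (negbTE yp) big -yq eqxx.
    move=> a z /star_colour2[[zf _ _ _]|[x0 [fx0 ex0 Haz xor]]] axzy.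
      case/orP: axzy => [/eqP ax|/eqP zy]; last by move: zf; rewrite zy => /fibreP[].
      by case/negP: xS; rewrite -ax; apply: fibre_centre zf.
    (* The extra edge of a single centre [x0] makes [x] adjacent to [p x0] or [x0] adjacent to [y].
       Either way [single_neighbour_fibre] contradicts [big]. *)
    have px0 : p x0 \in fibre s x0 by rewrite fx0 inE.
    have [Hx0 _ _ spx0] := fibreP px0.
    have ypx0 : y != p x0.
      by apply: contraNneq yp => e; rewrite {1}e -spx0 -e.
    have x0S := fibre_centre px0.
    suff: #|fibre s (s y)| <= 2 by rewrite leqNgt big.
    have [zp|zp] := eqVneq z (p x0).
      have ax : a = x.
        by case/orP: axzy => /eqP // zy; rewrite -zy zp eqxx in ypx0.
      by apply: (single_neighbour_fibre fx0 (x' := x)) => //; rewrite ?xS ?orbT // -ax -zp.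
    have ax0 : a = x0 by move: xor; rewrite (negbTE zp) addbF => /eqP.
    have zy : z = y.
      by case/orP: axzy => /eqP // ax; rewrite -ax ax0 x0S in xS.
    by apply: (single_neighbour_fibre fx0 (x' := x0)) => //; rewrite ?eqxx // -ax0 -zy.
  exists c0, (s y), y; split; rewrite ?eqxx ?(negbTE syx) //.
    by rewrite /c yf (negbTE yp) (negbTE small).
  move=> a z /star_colour0[zf _] /orP[/eqP ax|/eqP zy]; last first.
    by move: zf; rewrite zy => /fibreP[].
  by case/negP: xS; rewrite -ax; apply: fibre_centre zf.
have [pxf pxP] := private_nbrP xS.
have [yp|yp] := eqVneq y (p x); last first.
  exists c1, x, (p x); split; rewrite ?eqxx /= 1?eq_sym ?yp //.
    by rewrite /c pxf eqxx.
  move=> a z /star_colour1[zf zp] /orP[/eqP ax|/eqP zy]; first by rewrite -ax.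
  have aS := fibre_centre zf.
  have [_ aP] := private_nbrP aS.
  have xa : x = a by apply: aP => //; rewrite -zp zy.
  by case/eqP: yp; rewrite xa -zp zy.
have [_ _ _ spx] := fibreP pxf.
have syx : s y = x by rewrite yp.
have fibp a : p x \in fibre s a -> a = x by move=> /fibreP[_ _ _ <-].
(* A private neighbour sees only one centre, so the extra edge of a single centre [x0] can meet
   [x (p x)] only if [x0 = x]. *)
have px_single x0 a z : fibre s x0 = [set p x0] -> H a z ->
    (a == x0) (+) (z == p x0) -> (a == x) || (z == y) -> x0 = x.
  move=> fx0 Haz xor axzy.
  have px0 : p x0 \in fibre s x0 by rewrite fx0 inE.
  have x0S := fibre_centre px0.
  have [_ x0P] := private_nbrP x0S.
  have [zp|zp] := eqVneq z (p x0).
    case/orP: axzy => /eqP e; first by rewrite (x0P x) // -e -zp.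
    by apply: fibp; rewrite -yp -e zp.
  have ax0 : a = x0 by move: xor; rewrite (negbTE zp) addbF => /eqP.
  case/orP: axzy => /eqP e; first by rewrite -e.
  by apply: pxP => //; rewrite -yp -e -ax0.
have [big|small] := ltnP 2 #|fibre s x|.
  have [qf qp] := second_nbrP (ltnW big).
  exists c2, x, (q x); split; rewrite ?eqxx /= ?yp ?qp //.
    by rewrite /c qf (negbTE qp) big eqxx.
  move=> a z /star_colour2[[zf zp _ zq]|[x0 [fx0 ex0 Haz xor]]] axzy.
    case/orP: axzy => /eqP e; first by rewrite -e.
    have ax : a = x by apply: fibp; rewrite -e.
    by rewrite e ax eqxx in zp.
  rewrite -yp in axzy; have e := px_single _ _ _ fx0 Haz xor axzy.
  by move: big; rewrite -e fx0 cards1.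
have [two|one] := ltnP 1 #|fibre s x|.
  have [qf qp] := second_nbrP two.
  exists c0, x, (q x); split; rewrite ?eqxx /= ?yp ?qp //.
    by rewrite /c qf (negbTE qp) ltnNge small.
  move=> a z /star_colour0[zf zp] /orP[]/eqP e; last first.
    have ax : a = x by apply: fibp; rewrite -e.
    by rewrite e ax eqxx in zp.
  rewrite e in zf zp *; split=> //; apply/eqP; apply: contraTT small => zq.
  rewrite -ltnNge (cardsD1 (p x)) pxf (cardsD1 (q x)) !inE qp -mem_fibre qf.
  by rewrite (cardsD1 z) !inE zq zp -mem_fibre zf.
have fx : fibre s x = [set p x].
  by apply/esym/eqP; rewrite eqEcard sub1set pxf cards1 one.
case ex: (incident_edge x) => [[a z]|]; last first.
  have [z] := noniso; move: ex; rewrite /incident_edge; case: pickP => // none _.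
  case/orP=> /andP[Hz nz].
    by move: (none (x, z)); rewrite /= Hz gx eqxx -yp (negbTE nz).
  have gz : g z by move: (bipH Hxy) (bipH Hz); rewrite gx; case: (g y); case: (g z).
  by move: (none (z, y)); rewrite /= symH Hz gz -yp eqxx (negbTE nz).
have [Haz gz xor] : [/\ H a z, g a & (a == x) (+) (z == p x)].
  by move: ex; rewrite /incident_edge; case: pickP => // w /and3P[? ? ?] [e]; subst w.
exists c2, a, z; rewrite yp; split=> //.
  (* The fibre of [x] is just [p x], and [p x] is assigned to [x] alone; so the chosen edge is
     unassigned and the second clause of [star_colour] applies. *)
  have zf : z \notin fibre s a.
    apply: contraL xor => zf; have [zp|zp] := eqVneq z (p x).
      by rewrite (fibp a) ?eqxx // -zp.
    rewrite addbF; apply: contraNneq zp => ax.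
    by rewrite -in_set1 -fx -ax.
  rewrite /c (negbTE zf); case: existsP => // [[]]; exists x.
  by rewrite inE fx cards1 ex !eqxx.
move=> a' z' /star_colour2[[zf zp big _]|[x0 [fx0 ex0 Haz' xor']]] axzy.
  case/orP: axzy => /eqP e; first by move: big; rewrite e fx cards1.
  have ax : a' = x by apply: fibp; rewrite -e.
  by rewrite e ax eqxx in zp.
rewrite -yp in axzy; have e := px_single _ _ _ fx0 Haz' xor' axzy.
by move: ex0; rewrite e ex => -[-> ->].
Qed.

End Optimal.

Lemma bipartite_colouring : exists C : V -> V -> option 'I_3,
  [/\ forall u v, C u v = C v u, forall u v, C u v -> H u v &
   forall u v, H u v -> (exists a z, [/\ a \in [set u; v], z \notin [set u; v] & H a z]) ->
     pair_satisfied C [set u; v]].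
Proof.
have [s [dom_s opt_s]] := exists_optimal_dominating.
pose C u v := if g u then star_colour s u v else star_colour s v u.
have CE u v : C u v -> H u v.
  by rewrite /C; case: ifP => _ /(star_colour_edge dom_s)[]//; rewrite symH.
have Csym u v : C u v = C v u.
  have [Huv|nH] := boolP (H u v).
    by move: (bipH Huv); rewrite /C; case: (g u); case: (g v).
  have nC w w' : ~~ H w w' -> C w w' = None.
    by move/negP=> nw; case e: (C w w') => //; case: nw; apply: CE; rewrite e.
  by rewrite !nC // symH.
exists C; split=> // u v.
wlog gu : u v / g u.
  move=> IH Huv; have [gu|ngu] := boolP (g u); first exact: IH.
  rewrite setUC; apply: IH; last by rewrite symH.
  by move: (bipH Huv); rewrite (negbTE ngu); case: (g v).
move=> Huv [a0 [z0 [a0e z0e Haz0]]].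
have gv : ~~ g v by move: (bipH Huv); rewrite gu; case: (g v).
have uv : u != v by apply: contraNneq gv => <-.
have noniso : exists z, H u z && (z != v) || H v z && (z != u).
  exists z0; move: z0e; rewrite !inE => /norP[zu zv].
  by case/set2P: a0e Haz0 => -> ->; rewrite ?zu ?zv ?orbT.
have [b [x [y [cxy xor uniq]]]] := star_colour_spec dom_s opt_s Huv gu noniso.
have [Hxy gx] : H x y /\ g x by apply: (star_colour_edge dom_s); rewrite cxy.
have gy : ~~ g y by move: (bipH Hxy); rewrite gx; case: (g y).
have Cxy : C x y = Some b by rewrite /C gx.
have uniqC a z : C a z = Some b -> a \in [set u; v] ->
    (a = x /\ z = y) \/ (a = y /\ z = x).
  move=> Caz ae.
  have Haz : H a z by apply: CE; rewrite Caz.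
  move: Caz; rewrite /C; case: ifP => ga caz.
    left; apply: uniq => //; case/set2P: ae => ae; first by rewrite ae eqxx.
    by rewrite -ae ga in gv.
  right; have [] := uniq _ _ caz; last by move=> -> ->.
  by case/set2P: ae ga => ->; rewrite ?eqxx ?orbT // gu.
have [xu|xu] := eqVneq x u.
  have ye : y \notin [set u; v].
    move: xor; rewrite xu eqxx addTb !inE negb_or => ->; rewrite andbT.
    by apply: contraNneq gy => ->.
  exists b, x, y; split=> //; first by rewrite xu set21.
  by move=> a z ae /uniqC/(_ ae)[//|[ay _]]; rewrite ay (negbTE ye) in ae.
have yv : y = v by move: xor; rewrite (negbTE xu) => /eqP.
have xe : x \notin [set u; v].
  by rewrite !inE negb_or xu; apply: contraNneq gv => <-.
exists b, y, x; split=> //; first by rewrite yv set22.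
  by rewrite Csym.
by move=> a z ae /uniqC/(_ ae)[[ax _]|//]; rewrite ax (negbTE xe) in ae.
Qed.

End BipartiteColouring.

(** * Splitting a graph into bipartite levels *)

Section Levels.

Variables (V : finType) (G : rel V) (k : nat).
Hypothesis symG : symmetric G.
Hypothesis irrG : irreflexive G.

(** Each level carries its own sides, so that one level can be flipped without touching the
    others. *)
Definition bipartite_levels (lev : V -> V -> option 'I_k) (g : 'I_k -> pred V) :=
  (forall u v, lev u v = lev v u) /\
  (forall u v, G u v -> exists2 i, lev u v = Some i & g i u != g i v).

Definition lone (lev : V -> V -> option 'I_k) (u v : V) : bool :=
  G u v && [forall a in [set u; v], forall z, (z \notin [set u; v]) && G a z ==>
    (lev a z != lev u v)].

Lemma lone_lev lev u v a z : lone lev u v -> a \in [set u; v] ->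
  z \notin [set u; v] -> G a z -> lev a z != lev u v.
Proof.
move=> /andP[_ /forall_inP/(_ a)] lo ae ze Gaz.
by move/forallP/(_ z): (lo ae); rewrite ze Gaz.
Qed.

Lemma not_lone lev u v : G u v -> ~~ lone lev u v -> exists a z,
  [/\ a \in [set u; v], z \notin [set u; v], G a z & lev a z = lev u v].
Proof.
move=> Guv; rewrite /lone Guv /= negb_forall_in => /exists_inP[a ae].
rewrite negb_forall => /existsP[z]; rewrite negb_imply => /andP[/andP[ze Gaz]].
by rewrite negbK => /eqP; exists a, z.
Qed.

Lemma lone_sym lev u v : (forall a b, lev a b = lev b a) ->
  lone lev u v = lone lev v u.
Proof. by move=> sl; rewrite /lone symG setUC (sl u v). Qed.

Lemma eq_set2 (a z u v : V) : [set a; z] = [set u; v] -> u != v ->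
  (a = u /\ z = v) \/ (a = v /\ z = u).
Proof.
move=> e uv.
have: a \in [set u; v] by rewrite -e set21.
have: z \in [set u; v] by rewrite -e set22.
have: u \in [set a; z] by rewrite e set21.
have: v \in [set a; z] by rewrite e set22.
move=> /set2P[] ? /set2P[] ?; subst; rewrite ?eqxx // in uv *.
  by right.
by left.
Qed.

(* Two lone edges [u v] and [u w] can be merged into the level of [u w]: there
   [u w] is a component of its own, so flipping its sides is harmless. *)
Lemma merge_lone lev g u v w : bipartite_levels lev g ->
    lone lev u v -> lone lev u w -> v != w ->
  exists lev' g', bipartite_levels lev' g' /\
    [set e | lone lev' e.1 e.2] \proper [set e | lone lev e.1 e.2].
Proof.
move=> [symL bipL] luv luw vw.
have [Guv Guw] : G u v /\ G u w by case/andP: luv; case/andP: luw.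
have neqG a b : G a b -> a != b by move=> Gab; apply: contraTneq Gab => ->; rewrite irrG.
have [j levj gj] := bipL _ _ Guw.
have ve : v \notin [set u; w] by rewrite !inE negb_or vw eq_sym neqG.
have we : w \notin [set u; v] by rewrite !inE negb_or eq_sym neqG //= eq_sym.
pose lev' a z := if [set a; z] == [set u; v] then Some j else lev a z.
(* In level [j] the ends [u] and [v] must lie on different sides; the flip is made only if they do
   not. *)
pose g' l a := if [&& l == j, g j u == g j v & a \in [set u; w]] then ~~ g l a else g l a.
have lev'E a z : [set a; z] != [set u; v] -> lev' a z = lev a z.
  by rewrite /lev' => /negbTE->.
have out a z : z \notin [set u; v] -> [set a; z] != [set u; v].
  by apply: contraNneq => <-; rewrite set22.
have bip' : bipartite_levels lev' g'.
  split=> [a z|a z Gaz]; first by rewrite /lev' setUC symL.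
  rewrite /lev'; case: eqP => [eaz|_].
    suff g'uv : g' j u != g' j v.
      by exists j => //; case: (eq_set2 eaz (neqG _ _ Guv)) => -[-> ->] //; rewrite eq_sym.
    rewrite /g' eqxx set21 (negbTE ve) andbF andbT /=.
    by case: (g j u); case: (g j v).
  have [l ll gl] := bipL _ _ Gaz; exists l => //; rewrite /g'.
  case: (l =P j) => //= lj; subst l; case: (g j u == g j v) => //=.
  (* Since [u w] is lone, no edge of level [j] has exactly one end in the flipped set. *)
  have same : (a \in [set u; w]) = (z \in [set u; w]).
    have [ae|ae] := boolP (a \in _); have [ze|ze] := boolP (z \in _) => //.
      by have := lone_lev luw ae ze Gaz; rewrite ll levj eqxx.
    by have := lone_lev luw ze ae; rewrite symG symL ll levj eqxx => /(_ Gaz).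
  by rewrite same; case: ifP => // _; rewrite (inj_eq negb_inj).
exists lev', g'; split=> //; apply/properP; split; last first.
  (* The edge [u v] is no longer lone, as [u w] now shares its level. *)
  exists (u, v); rewrite !inE //=; apply: contraL we => lo; apply/negPn.
  apply: contraT => we; have := lone_lev lo (set21 u v) we Guw.
  by rewrite lev'E ?out // /lev' eqxx levj eqxx.
(* No edge becomes lone: one that lost [u v] as a neighbour in its level would have prevented [u v]
   from being lone before. *)
apply/subsetP=> -[a z]; rewrite !inE /= => lo.
have Gaz : G a z by case/andP: lo.
apply/andP; split=> //; apply/forall_inP=> b be; apply/forallP=> y.
apply/implyP=> /andP[ye Gby].
have [eaz|naz] := eqVneq [set a; z] [set u; v].
  have ->: lev a z = lev u v.
    by case: (eq_set2 eaz (neqG _ _ Guv)) => -[-> ->].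
  by rewrite eaz in be ye; exact: lone_lev luv be ye Gby.
have [eby|nby] := eqVneq [set b; y] [set u; v]; last first.
  by have := lone_lev lo be ye Gby; rewrite lev'E // (lev'E a z).
have bu : b \in [set u; v] by rewrite -eby set21.
have ->: lev b y = lev u v.
  by case: (eq_set2 eby (neqG _ _ Guv)) => -[-> ->].
have [o [Gbo lbo eo]] : exists o, [/\ G b o, lev b o = lev a z & [set b; o] = [set a; z]].
  case/set2P: be => ->; first by exists z.
  by exists a; rewrite symG symL setUC.
rewrite -lbo eq_sym; apply: (lone_lev luv) => //.
apply: contra naz => ou; rewrite -eo.
have := neqG _ _ Gbo; case/set2P: bu => ->; case/set2P: ou => ->; rewrite ?eqxx // => _.
by rewrite setUC.
Qed.

(** Each merge lowers the number of lone edges, counted as ordered pairs, so merging terminates. *)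
Lemma levels_without_lone_cherry lev g : bipartite_levels lev g ->
  exists lev' g', bipartite_levels lev' g' /\
    forall u v w, lone lev' u v -> lone lev' u w -> v = w.
Proof.
have [n] := ubnP #|[set e | lone lev e.1 e.2]|; elim: n lev g => // n IH lev g.
rewrite ltnS => le bip.
have [/existsP[u /existsP[v /existsP[w /and3P[luv luw vw]]]]|none] :=
  boolP [exists u, exists v, exists w, [&& lone lev u v, lone lev u w & v != w]].
  have [lev' [g' [bip' /proper_card lt]]] := merge_lone bip luv luw vw.
  by apply: (IH lev' g') => //; apply: leq_trans lt le.
exists lev, g; split=> // u v w luv luw; apply/eqP.
move/existsPn/(_ u)/existsPn/(_ v)/existsPn/(_ w): none.
by rewrite luv luw /= negbK.
Qed.

(** The level of an edge is a bit in which the colours of its ends differ; the value of this bit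
    gives the sides. *)
Lemma exists_levels (F : V -> {ffun 'I_k -> bool}) :
  (forall u v, G u v -> F u != F v) -> exists lev g, bipartite_levels lev g.
Proof.
move=> propF; exists (fun u v => [pick i | F u i != F v i]), (fun i u => F u i).
split=> [u v|u v /propF]; first by apply: eq_pick => i; rewrite /= eq_sym.
case: pickP => [i Fi _|none]; first by exists i.
by case/eqP; apply/ffunP=> i; move: (none i) => /negbFE/eqP.
Qed.

(** A vertex has at most one lone partner, so it can record whether it precedes this partner in the
    enumeration of [V]. *)
Lemma matching_sides lev : (forall a b, lev a b = lev b a) ->
    (forall u v w, lone lev u v -> lone lev u w -> v = w) ->
  exists t : pred V, forall u v, lone lev u v -> t u != t v.
Proof.
move=> sl match_l.
exists (fun u => [exists v, lone lev u v && (enum_rank u < enum_rank v)]) => u v luv.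
have E a b : lone lev a b ->
    [exists v, lone lev a v && (enum_rank a < enum_rank v)] = (enum_rank a < enum_rank b).
  move=> lab; apply/existsP/idP => [[b' /andP[lab' lt]]|lt].
    by rewrite (match_l _ _ _ lab lab').
  by exists b; rewrite lab.
rewrite (E u v) // (E v u); last by rewrite lone_sym.
have uv : u != v by apply: contraTneq luv => ->; rewrite /lone irrG.
have := inj_eq (@enum_rank_inj V) u v; rewrite (negbTE uv).
by rewrite -val_eqE /=; case: ltngtP.
Qed.

End Levels.

(** * Breadth-first depth and parents *)

Section Layers.

Variables (V : finType) (adj : rel V).
Hypothesis symA : symmetric adj.

Definition branching (y : V) : bool :=
  [exists a, exists b, [&& a != b, adj y a & adj y b]].

(** A branching vertex is preferred, to have two root edges with special tags. The choice depends
    only on [root adj x], hence is constant on components. *)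
Definition component_root (x : V) : V :=
  odflt (root adj x) [pick y | connect adj (root adj x) y && branching y].
Local Notation rt := component_root.

Lemma component_root_adj u v : adj u v -> rt u = rt v.
Proof.
move=> /connect1; rewrite -(root_connect (sym_connect_sym symA)) => /eqP e.
by rewrite /component_root e.
Qed.

Lemma connect_component_root x : connect adj (rt x) x.
Proof.
have symC := sym_connect_sym symA; rewrite symC.
rewrite /component_root; case: pickP => [y /andP[c _]|_] /=; last exact: connect_root.
exact: connect_trans (connect_root _ _) c.
Qed.

Lemma branching_component_root x : branching x -> branching (rt x).
Proof.
move=> bx; rewrite /component_root; case: pickP => [y /andP[]//|/(_ x)].
by rewrite bx (sym_connect_sym symA) connect_root.
Qed.

Definition walk_length (x : V) (n : nat) : bool :=
  [exists w : n.-tuple V, path adj (rt x) w && (last (rt x) w == x)].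

Lemma walk_lengthP x n : reflect
  (exists2 w, path adj (rt x) w & last (rt x) w = x /\ size w = n) (walk_length x n).
Proof.
apply: (iffP existsP) => [[w /andP[pw /eqP lw]]|[w pw [lw sw]]].
  by exists w => //; rewrite size_tuple.
have sw' : size w == n by apply/eqP.
by exists (Tuple sw'); rewrite /= pw lw eqxx.
Qed.

Lemma exists_walk x : exists n, walk_length x n.
Proof.
have /connectP[w pw lw] := connect_component_root x.
by exists (size w); apply/walk_lengthP; exists w.
Qed.

Definition depth (x : V) : nat := ex_minn (exists_walk x).

Lemma depth_walk x : walk_length x (depth x).
Proof. by rewrite /depth; case: ex_minnP. Qed.

Lemma depth_le x n : walk_length x n -> depth x <= n.
Proof. by rewrite /depth; case: ex_minnP => m _; apply. Qed.

Lemma depth_adj u v : adj u v -> depth v <= (depth u).+1.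
Proof.
move=> uv; apply: depth_le; apply/walk_lengthP.
have /walk_lengthP[w pw [lw sw]] := depth_walk u.
exists (rcons w v); rewrite -(component_root_adj uv).
  by rewrite rcons_path pw lw.
by rewrite last_rcons size_rcons sw.
Qed.

Lemma depth0 u : depth u = 0 -> u = rt u.
Proof.
move=> d0; have /walk_lengthP[w _ [lw]] := depth_walk u.
by rewrite d0; case: w lw.
Qed.

(** Take the last vertex but one of a shortest walk from the root. *)
Lemma depth_pred u : 0 < depth u -> exists2 p, adj u p & depth u = (depth p).+1.
Proof.
move=> gt0; have /walk_lengthP[w pw [lw sw]] := depth_walk u.
case/lastP: w pw lw sw => [|w x]; first by move=> _ _ /= e; rewrite -e in gt0.
rewrite rcons_path last_rcons size_rcons => /andP[pw px] xu sw; subst x.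
exists (last (rt u) w); first by rewrite symA.
apply/eqP; rewrite eqn_leq depth_adj // -sw ltnS; apply: depth_le.
by apply/walk_lengthP; exists w; rewrite (component_root_adj px).
Qed.

Definition parent (x : V) : V :=
  odflt x [pick p | adj x p && (depth x == (depth p).+1)].

Lemma parentP x : 0 < depth x -> adj x (parent x) /\ depth x = (depth (parent x)).+1.
Proof.
move=> /depth_pred[p xp dp]; rewrite /parent; case: pickP => [y /andP[? /eqP]//|/(_ p)].
by rewrite xp dp eqxx.
Qed.

End Layers.

(** * From colours of ordered pairs to colours of edges as sets *)

Section Transfer.

Variables (V : finType) (adj : rel V).
Hypothesis symA : symmetric adj.
Hypothesis irrA : irreflexive adj.

Lemma closed_nbhP (e f : {set V}) : f \in closed_nbh adj e ->
  exists a z, [/\ a \in e, adj a z & f = [set a; z]].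
Proof.
rewrite !inE => /andP[/existsP[u /existsP[v /andP[uv /eqP->]]]].
rewrite -setI_eq0 => /set0Pn[a]; rewrite inE => /andP[/set2P[] -> ae].
  by exists u, v.
by exists v, u; rewrite symA setUC.
Qed.

Lemma mem_open_nbh (e : {set V}) a z : a \in e -> z \notin e -> adj a z ->
  [set a; z] \in open_nbh adj e.
Proof.
move=> ae ze az; rewrite !inE; apply/and3P; split.
- by apply: contraNneq ze => <-; rewrite set22.
- by apply/existsP; exists a; apply/existsP; exists z; rewrite az eqxx.
by rewrite -setI_eq0; apply/set0Pn; exists a; rewrite inE set21.
Qed.

Lemma nonisolatedP u v : adj u v -> ~ isolated_edge adj [set u; v] ->
  exists a z, [/\ a \in [set u; v], z \notin [set u; v] & adj a z].
Proof.
move=> uv /eqP/set0Pn[f]; rewrite in_setD1 => /andP[fe /closed_nbhP[a [z [ae az ef]]]].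
exists a, z; split=> //; apply: contra fe => ze; rewrite ef.
have: a != z by apply: contraTneq az => ->; rewrite irrA.
by case/set2P: ae => ->; case/set2P: ze => ->; rewrite ?eqxx // => _; rewrite setUC.
Qed.

(** An edge takes the colour of some ordered pair representing it, numbered by [enum_rank]; by
    symmetry of [col] the choice of the pair does not matter. *)
Lemma pair_satisfied_transfer (K : finType) (n : nat) (col : V -> V -> option K) :
    #|K| <= n -> (forall a z, col a z = col z a) -> (forall a z, col a z -> adj a z) ->
  exists c : {set V} -> option 'I_n, forall u v, adj u v ->
    pair_satisfied col [set u; v] -> satisfied adj c [set u; v].
Proof.
move=> leKn symC supC.
pose code (b : K) : 'I_n := widen_ord leKn (enum_rank b).
have code_inj : injective code.
  by move=> b b' /(congr1 val) /= /val_inj/enum_rank_inj.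
pose c (e : {set V}) := if [pick w : V * V | adj w.1 w.2 && (e == [set w.1; w.2])]
  is Some w then omap code (col w.1 w.2) else None.
have cE a z : adj a z -> c [set a; z] = omap code (col a z).
  move=> az; rewrite /c; case: pickP => [[x y] /= /andP[xy /eqP e]|/(_ (a, z))].
    have nxy : x != y by apply: contraTneq xy => ->; rewrite irrA.
    by case: (eq_set2 e nxy) => -[-> ->] //; rewrite symC.
  by rewrite /= az eqxx.
exists c => u v uv [b [a [z [ae ze caz uniq]]]].
have az : adj a z by apply: supC; rewrite caz.
exists (code b), [set a; z]; first exact: mem_open_nbh.
split; first by rewrite cE // caz.
move=> f /closed_nbhP[a' [z' [a'e az' ->]]] ne; rewrite cE //.
apply: contra ne; case ca: (col a' z') => [b'|] //= /eqP/Some_inj/code_inj bb; subst b'.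
by have [-> ->] := uniq _ _ a'e ca.
Qed.

End Transfer.

(** * Combining tree colours and level colours *)

Section Colouring.

Variables (V : finType) (adj : rel V) (k : nat).
Hypothesis symA : symmetric adj.
Hypothesis irrA : irreflexive adj.
Variable F : V -> {ffun 'I_k -> bool}.
Hypothesis properF : forall u v, adj u v -> F u != F v.

Local Notation d := (depth symA).
Local Notation rt := (component_root adj).
Local Notation par := (parent symA).

Definition same_layer : rel V := fun u v => adj u v && (d u == d v).

Lemma same_layer_sym : symmetric same_layer.
Proof. by move=> u v; rewrite /same_layer symA eq_sym. Qed.

Lemma same_layer_irr : irreflexive same_layer.
Proof. by move=> u; rewrite /same_layer irrA. Qed.

Definition root_nbrs (r : V) : V * V :=
  odflt (r, r) [pick w : V * V | [&& w.1 != w.2, adj r w.1 & adj r w.2]].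

Lemma root_nbrsP r : branching adj r ->
  [/\ (root_nbrs r).1 != (root_nbrs r).2, adj r (root_nbrs r).1 & adj r (root_nbrs r).2].
Proof.
move=> /existsP[a /existsP[b abP]]; rewrite /root_nbrs.
by case: pickP => [w /and3P[]//|/(_ (a, b))]; rewrite /= abP.
Qed.

Section UpColour.

Variable t : pred V.

(** The tags 2 and 3 override the bit [t], so each of them occurs at most once per component. *)
Definition up_tag (x : V) : 'I_4 :=
  if x == (root_nbrs (rt x)).1 then inord 2
  else if x == (root_nbrs (rt x)).2 then inord 3 else inord (t x).

Definition up_code (x : V) : 'I_3 * 'I_4 := (inord (d x %% 3), up_tag x).

Definition up_colour (u v : V) : option ('I_3 * 'I_4) :=
  if (0 < d u) && (v == par u) then Some (up_code u)
  else if (0 < d v) && (u == par v) then Some (up_code v) else None.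

Lemma up_colourE x : 0 < d x -> up_colour x (par x) = Some (up_code x).
Proof. by move=> dx; rewrite /up_colour dx eqxx. Qed.

Lemma up_colour_sym u v : up_colour u v = up_colour v u.
Proof.
rewrite /up_colour; case: ifP => [/andP[du /eqP vu]|_].
  case: ifP => [/andP[dv /eqP uv]|//].
  have [_ eu] := parentP du; have [_ ev] := parentP dv.
  by have := ltnn (d u); rewrite {2}eu -vu ev -uv ltnS leqnSn.
by case: ifP.
Qed.

Lemma up_colourP u v b : up_colour u v = Some b ->
  (b = up_code u /\ v = par u /\ 0 < d u) \/ (b = up_code v /\ u = par v /\ 0 < d v).
Proof.
rewrite /up_colour; case: ifP => [/andP[du /eqP vu] [<-]|_]; first by left.
by case: ifP => [/andP[dv /eqP uv] [<-]|//]; right.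
Qed.

Lemma up_code_mod x y : up_code x = up_code y -> d x = d y %[mod 3].
Proof. by case=> /(congr1 val) /=; rewrite !inordK ?ltn_mod. Qed.

Lemma modn3_neq n : (n.+1 != n %[mod 3]) * (n.+2 != n %[mod 3]).
Proof.
split; first by rewrite -addn1 -[X in _ != X %[mod _]]addn0 eqn_modDl.
by rewrite -addn2 -[X in _ != X %[mod _]]addn0 eqn_modDl.
Qed.

Lemma up_tag_nbr x :
  (up_tag x = inord 2 -> x = (root_nbrs (rt x)).1) /\
  (up_tag x = inord 3 -> x = (root_nbrs (rt x)).2).
Proof.
rewrite /up_tag; case: eqP => [e|_].
  by split=> // /(congr1 val); rewrite /= !inordK.
case: eqP => [e|_]; first by split=> // /(congr1 val); rewrite /= !inordK.
by split=> /(congr1 val); rewrite /= !inordK //; case: (t x).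
Qed.

Lemma up_tag_neq u v : rt u = rt v -> u != v -> t u != t v -> up_tag u != up_tag v.
Proof.
move=> e uv tuv; apply/eqP; rewrite /up_tag e.
case: (u =P _) => [u1|_]; case: (v =P (root_nbrs (rt v)).1) => [v1|_].
- by case/eqP: uv; rewrite u1.
- by case: ifP => _ /(congr1 val); rewrite /= !inordK //; case: (t v).
- by case: ifP => _ /(congr1 val); rewrite /= !inordK //; case: (t u).
case: (u =P _) => [u2|_]; case: (v =P _) => [v2|_].
- by case/eqP: uv; rewrite u2.
- by move/(congr1 val); rewrite /= !inordK //; case: (t v).
- by move/(congr1 val); rewrite /= !inordK //; case: (t u).
by move/(congr1 val); rewrite /= !inordK; move: tuv; case: (t u); case: (t v).
Qed.

(** Apart from the parent edge of [u], the tree edges at [u] or [v] have lower ends of depth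
    [d u + 1] or [d u + 2], different from [d u] modulo 3. *)
Lemma up_satisfied_below u v : adj u v -> d v = (d u).+1 -> 0 < d u ->
  pair_satisfied up_colour [set u; v].
Proof.
move=> uv dv du; have [up eu] := parentP du.
exists (up_code u), u, (par u); split; rewrite ?set21 ?up_colourE //.
  have lt : d (par u) < d u by rewrite eu.
  rewrite !inE negb_or; apply/andP.
  by split; apply: contraTneq lt => ->; rewrite -leqNgt ?dv ?leqnSn.
move=> a z ae /up_colourP[[e [-> da]]|[e [az dz]]].
  case/set2P: ae e => -> // /up_code_mod/eqP.
  by rewrite dv eq_sym (negbTE (modn3_neq _).1).
have [_] := parentP dz; rewrite -az => dz'.
move/up_code_mod/eqP: e; rewrite dz' eq_sym.
by case/set2P: ae => ->; rewrite ?dv ?(negbTE (modn3_neq _).1) ?(negbTE (modn3_neq _).2).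
Qed.

(** The parent edges of [u] and [v] have equal depth but different tags; edges to children lie one
    layer lower. *)
Lemma up_satisfied_same u v : adj u v -> d u = d v -> t u != t v ->
  pair_satisfied up_colour [set u; v].
Proof.
move=> uv dv tuv.
have nuv : u != v by apply: contraTneq uv => ->; rewrite irrA.
have rtuv := component_root_adj symA uv.
have du : 0 < d u.
  rewrite lt0n; apply: contraNneq nuv => d0.
  by rewrite (depth0 d0) rtuv -depth0 // -dv.
have [up eu] := parentP du.
exists (up_code u), u, (par u); split; rewrite ?set21 ?up_colourE //.
  have lt : d (par u) < d u by rewrite eu.
  rewrite !inE negb_or; apply/andP.
  by split; apply: contraTneq lt => ->; rewrite -leqNgt ?dv.
move=> a z ae /up_colourP[[e [-> da]]|[e [az dz]]].
  case/set2P: ae e => -> // -[_ /eqP].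
  by rewrite (negbTE (up_tag_neq rtuv nuv tuv)).
have [_] := parentP dz; rewrite -az => dz'.
move/up_code_mod/eqP: e; rewrite dz' eq_sym.
by case/set2P: ae => ->; rewrite -?dv (negbTE (modn3_neq _).1).
Qed.

(** One of the two specially tagged neighbours of the root is not [v], and its tag occurs nowhere
    else in the component. *)
Lemma up_satisfied_root u v : adj u v -> d u = 0 -> branching adj (rt u) ->
  pair_satisfied up_colour [set u; v].
Proof.
move=> uv d0 br; have [n12 n1 n2] := root_nbrsP br.
have ur := depth0 d0; rewrite -ur in n12 n1 n2.
have child w : adj u w -> 0 < d w /\ par w = u.
  move=> uw; have ruw := component_root_adj symA uw.
  have dw : 0 < d w.
    rewrite lt0n; apply: contraTneq uw => dw.
    by rewrite (depth0 dw) -ruw -ur irrA.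
  split=> //; have [wp ew] := parentP dw.
  have := depth_adj symA uw; rewrite d0 ew ltnS leqn0 => /eqP dp.
  by rewrite (depth0 dp) -(component_root_adj symA wp) -ruw.
have main w (tg : 'I_4) : adj u w -> w != v -> up_tag w = tg ->
    (forall x, rt x = rt u -> up_tag x = tg -> x = w) -> pair_satisfied up_colour [set u; v].
  move=> uw wv tw uniq; have [dw pw] := child w uw.
  exists (up_code w), u, w; split; rewrite ?set21 //.
  - rewrite !inE negb_or wv andbT; apply: contraTneq uw => ->; by rewrite irrA.
  - by rewrite up_colour_sym -{1}pw up_colourE.
  move=> a z ae /up_colourP[[e [az da]]|[e [az dz]]].
    have ra : rt a = rt u.
      by case/set2P: ae => -> //; rewrite (component_root_adj symA uv).
    have aw : a = w by apply: uniq => //; case: e => _ <-.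
    move: ae; rewrite aw !inE (negbTE wv) orbF => /eqP wu.
    by rewrite wu irrA in uw.
  have [zp _] := parentP dz; rewrite -az in zp.
  have rz : rt z = rt u.
    rewrite (component_root_adj symA zp).
    by case/set2P: ae => -> //; rewrite (component_root_adj symA uv).
  have zw : z = w by apply: uniq => //; case: e => _ <-.
  by rewrite az zw pw.
have [v1|v1] := eqVneq (root_nbrs u).1 v.
  apply: (main (root_nbrs u).2 (inord 3)) => //.
  - by rewrite -v1 eq_sym.
  - by rewrite /up_tag -(component_root_adj symA n2) -ur eq_sym (negbTE n12) eqxx.
  by move=> x rx /(up_tag_nbr _).2->; rewrite rx -ur.
apply: (main (root_nbrs u).1 (inord 2)) => //.
  by rewrite /up_tag -(component_root_adj symA n1) -ur eqxx.
by move=> x rx /(up_tag_nbr _).1->; rewrite rx -ur.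
Qed.

End UpColour.

(** The left summand serves the edges inside layers (level and colour within it), the right one the
    tree edges; disjoint palettes cannot interfere. *)
Lemma exists_pair_colouring :
  exists col : V -> V -> option ('I_k * 'I_3 + 'I_3 * 'I_4),
  [/\ forall a z, col a z = col z a, forall a z, col a z -> adj a z &
   forall u v, adj u v ->
     (exists a z, [/\ a \in [set u; v], z \notin [set u; v] & adj a z]) ->
     pair_satisfied col [set u; v]].
Proof.
have [lev0 [g0 bip0]] : exists lev g, bipartite_levels (k := k) same_layer lev g.
  by apply: (exists_levels (F := F)) => u v /andP[/properF].
have [lev [g [[symL bipL] match_l]]] :=
  levels_without_lone_cherry same_layer_sym same_layer_irr bip0.
have [t tP] := matching_sides same_layer_sym same_layer_irr symL match_l.
pose H i : rel V := fun u v => same_layer u v && (lev u v == Some i).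
have symH i : symmetric (H i) by move=> u v; rewrite /H same_layer_sym symL.
have bipH i u v : H i u v -> g i u != g i v.
  by move=> /andP[/bipL[j -> gj] /eqP[<-]].
have [C CP] := fin_all_exists (fun i => bipartite_colouring (symH i) (@bipH i)).
pose col u v : option ('I_k * 'I_3 + 'I_3 * 'I_4) :=
  if d u == d v then obind (fun i => omap (fun b => inl (i, b)) (C i u v)) (lev u v)
  else omap inr (up_colour t u v).
have colE a z i b : col a z = Some (inl (i, b)) <-> C i a z = Some b.
  rewrite /col; split=> [|Cb].
    case: ifP => _; last by case: up_colour.
    by case: (lev a z) => //= j; case Cj: (C j a z) => [b'|] //= [<- <-].
  have [_ /(_ a z)] := CP i; rewrite Cb => /(_ isT)/andP[/andP[_ ->] /eqP->] _ /=.
  by rewrite Cb.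
have up_adj a z b : up_colour t a z = Some b -> adj a z /\ d a != d z.
  move/up_colourP=> [[_ [-> /parentP[ap ->]]]|[_ [-> /parentP[zp ->]]]].
    by rewrite ap neq_ltn ltnSn orbT.
  by rewrite symA zp neq_ltn ltnSn.
have colE' a z b : col a z = Some (inr b) <-> up_colour t a z = Some b.
  rewrite /col; split=> [|ub].
    case: ifP => _; last by case: up_colour => //= b' [<-].
    by case: (lev a z) => //= j; case: (C j a z).
  by have [_ /negbTE->] := up_adj _ _ _ ub; rewrite ub.
have up_sat u v : pair_satisfied (up_colour t) [set u; v] -> pair_satisfied col [set u; v].
  move=> [b [a [z [ae ze caz uniq]]]]; exists (inr b), a, z; split=> //.
    by apply/colE'.
  by move=> a' z' a'e /colE'; apply: uniq.
exists col; split.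
- move=> a z; rewrite /col eq_sym symL up_colour_sym; case: ifP => // _.
  by case: (lev z a) => //= i; have [-> _ _] := CP i.
- move=> a z; case caz: (col a z) => [[[i b]|b]|] // _.
    move/colE: caz => Cb; have [_ /(_ a z)] := CP i.
    by rewrite Cb => /(_ isT)/andP[/andP[]].
  by move/colE': caz => /up_adj[].
move=> u v uv noniso.
(* An edge with an adjacent edge has an end with two neighbours, so a branching root was
   available. *)
have br : branching adj (rt u).
  have [a [z [ae ze az]]] := noniso.
  have -> : rt u = rt a.
    by case/set2P: ae => -> //; apply: component_root_adj.
  apply: (branching_component_root symA).
  move: ze; rewrite !inE => /norP[zu zv].
  case/set2P: ae az => -> az; apply/existsP; exists z; apply/existsP.
    by exists v; rewrite zv az uv.
  by exists u; rewrite zu az symA uv.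
have [duv|duv] := eqVneq (d u) (d v); last first.
  apply: up_sat; move: duv br uv; clear noniso.
  wlog lt : u v / d u < d v.
    move=> IH duv br uv; case: (ltngtP (d u) (d v)) duv => // lt _.
      by apply: IH => //; rewrite neq_ltn lt.
    rewrite setUC; apply: IH => //; first by rewrite neq_ltn lt.
      by rewrite -(component_root_adj symA uv).
    by rewrite symA.
  move=> _ br uv; have [d0|dgt] := posnP (d u); first exact: up_satisfied_root.
  by apply: up_satisfied_below => //; apply/eqP; rewrite eqn_leq lt depth_adj.
have suv : same_layer u v by rewrite /same_layer uv duv eqxx.
(* A lone edge relies on the tags of its ends; any other has a neighbour in its level, as
   [bipartite_colouring] requires. *)
have [luv|nl] := boolP (lone same_layer lev u v).
  by apply: up_sat; apply: up_satisfied_same => //; apply: tP.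
have [i li _] := bipL _ _ suv.
have [a [z [ae ze saz laz]]] := not_lone suv nl.
have [_ _ /(_ u v)] := CP i; case.
- by rewrite /H suv li eqxx.
- by exists a, z; rewrite /H saz laz li eqxx.
move=> b [a' [z' [ae' ze' caz uniq]]]; exists (inl (i, b)), a', z'; split=> //.
  by apply/colE.
by move=> a1 z1 a1e /colE; apply: uniq.
Qed.

End Colouring.

Theorem mainTheorem10 (V : finType) (adj : rel V) (alpha : nat) :
  simple_graph adj -> 1 <= alpha -> chromatic_le adj alpha ->
  exists c : {set V} -> option 'I_(3 * up_log 2 alpha + 16),
    forall e, e \in edges adj -> ~ isolated_edge adj e -> satisfied adj c e.
Proof.
move=> [symA irrA] _ [f fP]; set k := up_log 2 alpha.
have le2k : alpha <= #|{ffun 'I_k -> bool}|.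
  by rewrite card_ffun card_bool card_ord up_logP.
pose F u := enum_val (widen_ord le2k (f u)).
have properF u v : adj u v -> F u != F v.
  move=> /fP; apply: contraNneq => /enum_val_inj/(congr1 val) /= e.
  exact/eqP/val_inj.
have [col [symC supC satC]] := exists_pair_colouring symA irrA properF.
(* The palette has [3 * k + 12] elements. *)
have leK : #|{: 'I_k * 'I_3 + 'I_3 * 'I_4}| <= 3 * k + 16.
  by rewrite card_sum !card_prod !card_ord mulnC leq_add2l.
have [c cP] := pair_satisfied_transfer symA irrA leK symC supC.
exists c => e; rewrite inE => /existsP[u /existsP[v /andP[uv /eqP->]]] niso.
by apply: cP => //; apply: satC => //; apply: nonisolatedP.
Qed.
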